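(* Let $\mathbb{F}$ be a field and let $L$ be a nilpotent symplectic alternating algebra over $\mathbb{F}$ of dimension $10$ with an isotropic centre of dimension $3$ that has the further properties that $\dim L^{3}=6$, $L^{3}L^{2}=L^{5}$ and $L$ is of type B. Then $L$ has a presentation of the form $$\mathcal{P}_{10}^{(3,7)}(r):\ (x_{2}y_{4},y_{5})=r,\ (x_{1}y_{2},y_{4})=1,\ (y_{1}y_{2},y_{5})=1,\ (y_{1}y_{3},y_{4})=1$$ where $r\in\mathbb{F}$, $r\neq 0$. Furthermore, for $r,s\in\mathbb{F}\setminus\{0\}$, the presentations $\mathcal{P}_{10}^{(3,7)}(r)$ and $\mathcal{P}_{10}^{(3,7)}(s)$ describe the same algebra (up to isomorphism) if and only if $s/r\in(\mathbb{F}^{*})^{3}$.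
   Context: A symplectic alternating algebra (SAA) over a field $\mathbb{F}$ is a finite-dimensional $\mathbb{F}$-vector space $L$ with a non-degenerate alternating bilinear form $(\ ,\ )$ and a bilinear alternating product $L\times L\to L$, $(x,y)\mapsto xy$ (so $xx=0$), such that $(xy,z)=(yz,x)$ for all $x,y,z\in L$. It follows that $(x,y,z)\mapsto (xy,z)$ is an alternating trilinear form. Isomorphisms of SAAs are linear bijections preserving the form and the product. For subspaces $A,B$, $AB$ denotes the linear span of all products $ab$ with $a\in A,b\in B$. The lower central series is $L^1=L$, $L^{k+1}=L^k L$; the upper central series is $Z_0(L)=0$, $Z_{k+1}(L)=\{x\in L: xL\leq Z_k(L)\}$, with $Z(L)=Z_1(L)$ the centre. $L$ is nilpotent if $L^{k}=0$ for some $k$. A subspace is isotropic if the form vanishes identically on it. A standard basis of a $10$-dimensional SAA is a basis $x_1,y_1,\ldots,x_5,y_5$ with $(x_i,x_j)=(y_i,y_j)=0$ and $(x_i,y_j)=\delta_{ij}$ for all $i,j$. A presentation lists values of triples $(uv,w)$ with $u,v,w$ distinct elements of a standard basis; the convention is that all triple values of basis elements not listed (and not determined from the listed ones by the alternating property) are $0$. Such data determine the product, hence the SAA, uniquely. $\mathbb{F}^{*}=\mathbb{F}\setminus\{0\}$ and $(\mathbb{F}^{*})^{3}=\{b^3: b\in\mathbb{F}^{*}\}$. Types. Let $L$ be a nilpotent SAA of dimension $10$ with isotropic centre of dimension $3$, $\dim L^3=6$ and $L^3L^2=L^5$. Then one can choose a standard basis adapted to the central series in the sense that $L^{5}=\mathbb{F}x_{5}+\mathbb{F}x_{4}$,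 $Z(L)=L^5+\mathbb{F}x_{3}$, $Z_{2}(L)=L^{4}=Z(L)+\mathbb{F}x_{2}$, $Z_{3}(L)=L^{3}=L^4+\mathbb{F}x_{1}+\mathbb{F}y_{1}$, $L^{2}=L^{3}+\mathbb{F}y_{2}$, $Z_{4}(L)=L^{3}+\mathbb{F}y_{2}+\mathbb{F}y_{3}$. Since $L^4Z_4(L)=0$, the linear maps $\phi,\psi: L^{3}/L^{4}\to L^{5}$, $\phi(u+L^4)=uy_2$, $\psi(u+L^4)=uy_3$, are well defined; $\phi$ is bijective because $L^3L^2=L^5$. Put $\tau=\psi\phi^{-1}:L^5\to L^5$. The minimal polynomial of $\tau$ has degree $2$, and exactly one of the following holds, independently of the choice of adapted standard basis: type A: the minimal polynomial of $\tau$ has two distinct roots in $\mathbb{F}$; type B: it has a double root in $\mathbb{F}$; type C: it is irreducible in $\mathbb{F}[t]$. *)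

(* Defs.v *)
From HB Require Import structures.
From mathcomp Require Import all_boot all_order all_algebra.
From mathcomp Require Import ring.

Set Implicit Arguments.
Unset Strict Implicit.
Unset Printing Implicit Defensive.

Import GRing.Theory.
Local Open Scope ring_scope.

Record saa (F : fieldType) := Saa {
  saa_space :> vectType F;
  saa_form : {biscalar saa_space};
  saa_mul : {bilinear saa_space -> saa_space -> saa_space};
  saa_form_alt : forall x, saa_form x x = 0;
  saa_form_nondeg : forall x, (forall y, saa_form x y = 0) -> x = 0;
  saa_mul_alt : forall x, saa_mul x x = 0;
  saa_form_mulC : forall x y z, saa_form (saa_mul x y) z = saa_form (saa_mul y z) x
}.

Arguments saa_form {F s}.
Arguments saa_mul {F s}.

Section Theory.
Variables (F : fieldType) (L : saa F).
Implicit Types A B U : {vspace L}.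

(* The products of basis vectors suffice to span AB; see prodsvP. *)
Definition prodsv A B : {vspace L} :=
  <<[seq saa_mul a b | a : L <- vbasis A, b : L <- vbasis B]>>%VS.

Lemma memv_prodsv A B a b : a \in A -> b \in B -> saa_mul a b \in prodsv A B.
Proof.
move=> /coord_vbasis-> /coord_vbasis->.
rewrite linear_sumlz; apply: memv_suml => i _.
rewrite linear_sumr; apply: memv_suml => j _.
rewrite linearZl_LR linearZr_LR !memvZ // memv_span //.
by apply/allpairsP; exists ((vbasis A)`_i, (vbasis B)`_j); rewrite !mem_nth ?size_tuple.
Qed.

Lemma prodsvP A B U :
  reflect (forall a b, a \in A -> b \in B -> saa_mul a b \in U)
          (prodsv A B <= U)%VS.
Proof.
apply: (iffP idP) => [/subvP sU a b aA bB|AB_U].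
  exact/sU/memv_prodsv.
apply/span_subvP => _ /allpairsP[[a b] /= [aA bB ->]].
by apply: AB_U; apply: vbasis_mem.
Qed.

(* lcs k is L^k for 0 < k; lcs 0 is also L. *)
Definition lcs (k : nat) : {vspace L} := iter k.-1 (prodsv^~ fullv) fullv.

(* ucs k is Z_k(L); see ucsSP. *)
Fixpoint ucs (k : nat) : {vspace L} :=
  if k is k'.+1 then
    (\bigcap_(y <- vbasis {:L}) (linfun (applyr saa_mul y) @^-1: ucs k'))%VS
  else 0%VS.

Lemma ucsSP k x :
  reflect (forall y, saa_mul x y \in ucs k) (x \in ucs k.+1).
Proof.
have -> : (x \in ucs k.+1) = all (fun y => saa_mul x y \in ucs k) (vbasis {:L}).
  rewrite /=; elim: (tval _) => [|y s IHs]; first by rewrite big_nil memvf.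
  by rewrite big_cons memv_cap IHs -memv_preim lfunE.
apply: (iffP allP) => [Zx y|Zx y _]; last exact: Zx.
rewrite (coord_vbasis (memvf y)) linear_sumr; apply: memv_suml => i _.
by rewrite linearZr_LR memvZ ?Zx ?mem_nth ?size_tuple.
Qed.

Definition centre : {vspace L} := ucs 1.

Definition saa_nilpotent : Prop := exists k, lcs k = 0%VS.

Definition isotropic U : Prop :=
  forall x y, x \in U -> y \in U -> saa_form x y = 0.

End Theory.

Definition saa_iso (F : fieldType) (L M : saa F) : Prop :=
  exists f : 'Hom(L, M),
    [/\ bijective f,
        forall x y, saa_form (f x) (f y) = saa_form x y
      & forall x y, f (saa_mul x y) = saa_mul (f x) (f y)].

Section Presentations.
Variable F : fieldType.

(* Indices are shifted: x_(k+1), y_(k+1) in the mathematical numbering are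
   x k, y k for k : 'I_5. *)
Definition standard_basis (L : saa F) (x y : 'I_5 -> L) : Prop :=
  [/\ basis_of {:L} (codom x ++ codom y),
      forall i j, saa_form (x i) (x j) = 0,
      forall i j, saa_form (y i) (y j) = 0
    & forall i j, saa_form (x i) (y j) = (i == j)%:R].

(* inl i stands for x i and inr i for y i. *)
Definition gen : Type := ('I_5 + 'I_5)%type.

Definition gen_val (L : saa F) (x y : 'I_5 -> L) (g : gen) : L :=
  match g with inl i => x i | inr i => y i end.

(* gX k and gY k are numbered from 1 to 5. *)
Definition gX (k : nat) : gen := inl (inord k.-1).
Definition gY (k : nat) : gen := inr (inord k.-1).

(* (u, v, w, c) stands for (uv, w) = c. *)
Definition presentation : Type := seq (gen * gen * gen * F).

Definition listed (p : presentation) (u v w : gen) : Prop :=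
  exists2 e, e \in p &
    perm_eq [:: u; v; w] [:: e.1.1.1; e.1.1.2; e.1.2].

Definition has_presentation (L : saa F) (p : presentation) : Prop :=
  exists x y : 'I_5 -> L,
    [/\ standard_basis x y,
        forall u v w c, (u, v, w, c) \in p ->
          saa_form (saa_mul (gen_val x y u) (gen_val x y v)) (gen_val x y w) = c
      & forall u v w, ~ listed p u v w ->
          saa_form (saa_mul (gen_val x y u) (gen_val x y v)) (gen_val x y w) = 0].

Definition P10_3_7 (r : F) : presentation :=
  [:: (gX 2, gY 4, gY 5, r); (gX 1, gY 2, gY 4, 1);
      (gY 1, gY 2, gY 5, 1); (gY 1, gY 3, gY 4, 1)].

End Presentations.

(* Presentations are realized on the space of coordinate vectors; for
   P10_3_7 r this is P10_3_7_realized below. *)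
Section Realization.
Variable F : fieldType.
Local Notation V := {ffun gen -> F^o}.

Definition coord_form (u v : V) : F :=
  \sum_i (u (inl i) * v (inr i) - u (inr i) * v (inl i)).

Definition det3 (a b c : gen) (u v w : V) : F :=
  u a * (v b * w c - v c * w b) + u b * (v c * w a - v a * w c)
  + u c * (v a * w b - v b * w a).

(* The alternating trilinear form sum of c (u^* /\ v^* /\ w^* ) over the entries
   (u, v, w, c) of p. *)
Definition triple (p : presentation F) (u v w : V) : F :=
  \sum_(e <- p) e.2 * det3 e.1.1.1 e.1.1.2 e.1.2 u v w.

Definition delta (g : gen) : V := [ffun h => (h == g)%:R].

Definition coord_mul (p : presentation F) (u v : V) : V :=
  [ffun g => match g with
             | inl i => triple p u v (delta (inr i))
             | inr i => - triple p u v (delta (inl i))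
             end].

Fact coord_form_bilinear : bilinear_for *%R *%R coord_form.
Proof.
split=> w a u v; rewrite /coord_form /= mulr_sumr -big_split /=;
  by apply: eq_bigr => i _; rewrite !ffunE /GRing.scale /=; ring.
Qed.
HB.instance Definition _ :=
  bilinear_isBilinear.Build F V V F *%R *%R coord_form coord_form_bilinear.

Fact triple_linear p a u u' v w :
  triple p (a *: u + u') v w = a * triple p u v w + triple p u' v w.
Proof.
rewrite /triple mulr_sumr -big_split /=; apply: eq_bigr => e _.
by rewrite /det3 !ffunE /GRing.scale /=; ring.
Qed.

Fact triple_rot p u v w : triple p u v w = triple p v w u.
Proof. by apply: eq_bigr => e _; rewrite /det3; ring. Qed.

Fact triple_alt p u w : triple p u u w = 0.
Proof. by apply: big1 => e _; rewrite /det3; ring. Qed.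

Fact coord_mul_bilinear p : bilinear_for *:%R *:%R (coord_mul p).
Proof.
split=> w a u v; apply/ffunP=> -[] i; rewrite !ffunE /GRing.scale /=.
- exact: triple_linear.
- by rewrite triple_linear; ring.
- by rewrite !(triple_rot p w) triple_linear.
- by rewrite !(triple_rot p w) triple_linear; ring.
Qed.
HB.instance Definition _ p :=
  bilinear_isBilinear.Build F V V V *:%R *:%R (coord_mul p) (coord_mul_bilinear p).

Fact coord_form_alt u : coord_form u u = 0.
Proof. by apply: big1 => i _; ring. Qed.

Fact coord_form_delta u g : coord_form u (delta g) =
  match g with inl i => - u (inr i) | inr i => u (inl i) end.
Proof.
case: g => i; rewrite /coord_form (bigD1 i) //= big1 => [|j /negPf ji].
all: by rewrite !ffunE ?eqxx ?[inl _ == inl _]ji ?[inr _ == inr _]ji /=; ring.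
Qed.

Fact coord_form_nondeg u : (forall v, coord_form u v = 0) -> u = 0.
Proof.
move=> u0; apply/ffunP=> -[] i; rewrite ffunE.
  by rewrite -(u0 (delta (inr i))) coord_form_delta.
by apply: oppr_inj; rewrite oppr0 -(u0 (delta (inl i))) coord_form_delta.
Qed.

Fact sum_delta (u : V) : u = \sum_g u g *: delta g.
Proof.
apply/ffunP=> h; rewrite sum_ffunE (bigD1 h) //= big1 => [|g /negPf gh].
  by rewrite !ffunE eqxx /GRing.scale /=; ring.
by rewrite !ffunE eq_sym gh /GRing.scale /=; ring.
Qed.

Fact triple_sum p u v w :
  triple p u v w = \sum_g w g * triple p u v (delta g).
Proof.
rewrite -triple_rot.
have t0 : triple p 0 u v = 0 by apply: big1 => e _; rewrite /det3 !ffunE; ring.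
rewrite {1}[w]sum_delta.
elim: (index_enum _) => [|g s IHs]; first by rewrite !big_nil t0.
by rewrite !big_cons triple_linear IHs triple_rot.
Qed.

Fact coord_mulC p u v w :
  coord_form (coord_mul p u v) w = triple p u v w.
Proof.
rewrite triple_sum big_sumType /= -big_split /=.
by apply: eq_bigr => i _; rewrite !ffunE; ring.
Qed.

Fact coord_form_mulC p u v w :
  coord_form (coord_mul p u v) w = coord_form (coord_mul p v w) u.
Proof. by rewrite !coord_mulC triple_rot. Qed.

Fact coord_mul_alt p u : coord_mul p u u = 0.
Proof. by apply/ffunP=> -[] i; rewrite !ffunE !triple_alt ?oppr0. Qed.

Definition presented_saa (p : presentation F) : saa F :=
  @Saa F V coord_form (coord_mul p) coord_form_alt coord_form_nondeg
    (coord_mul_alt p) (coord_form_mulC p).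

Lemma presented_standard_basis p :
  @standard_basis F (presented_saa p) (fun i => delta (inl i)) (fun i => delta (inr i)).
Proof.
split=> [|i j|i j|i j]; last 3 first.
- by rewrite [LHS](coord_form_delta (delta _)) ffunE oppr0.
- by rewrite [LHS](coord_form_delta (delta _)) ffunE.
- by rewrite [LHS](coord_form_delta (delta _)) ffunE eq_sym.
rewrite basisEdim size_cat !size_codom card_ord; apply/andP; split; last first.
  by rewrite dimvf /dim /= card_sum card_ord.
apply/subvP=> u _; rewrite [u]sum_delta; apply: memv_suml => g _.
rewrite memvZ // memv_span // mem_cat.
by case: g => i; apply/orP; [left|right]; apply: codom_f.
Qed.

Lemma presented_mul p u v w :
  saa_form (saa_mul (delta u : presented_saa p) (delta v)) (delta w : presented_saa p)
  = triple p (delta u) (delta v) (delta w).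
Proof. exact: coord_mulC. Qed.

Lemma P10_3_7_realized r : has_presentation (presented_saa (P10_3_7 r)) (P10_3_7 r).
Proof.
exists (fun i => delta (inl i)), (fun i => delta (inr i)).
have val g : @gen_val F (presented_saa (P10_3_7 r)) (fun i => delta (inl i))
    (fun i => delta (inr i)) g = delta g by case: g.
split=> [|u v w c|u v w nl]; first exact: presented_standard_basis.
  rewrite !val presented_mul /triple !inE !big_cons big_nil /det3 /= !ffunE.
  rewrite /gX /gY /=.
  have ieq (i j : nat) : (i < 5)%N -> (j < 5)%N -> (inord i == inord j :> 'I_5) = (i == j).
    by move=> i5 j5; rewrite -val_eqE /= !inordK.
  have eq1 (i j : 'I_5) : (inl i == inl j :> gen) = (i == j) by [].
  have eq2 (i j : 'I_5) : (inr i == inr j :> gen) = (i == j) by [].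
  have eq3 (i j : 'I_5) : (inl i == inr j :> gen) = false by [].
  have eq4 (i j : 'I_5) : (inr i == inl j :> gen) = false by [].
  by case/or4P=> /eqP[-> -> -> ->]; rewrite !(eq1, eq2, eq3, eq4) !ieq //=; ring.
rewrite !val presented_mul; apply: big1_seq => e /andP[_ ep].
suff -> : det3 e.1.1.1 e.1.1.2 e.1.2 (delta u) (delta v) (delta w) = 0 by rewrite mulr0.
apply/eqP/negPn/negP=> dn0; apply: nl; exists e => //; move: dn0.
move: e.1.1.1 e.1.1.2 e.1.2 => a b c; rewrite /det3 !ffunE => dn0.
have E : [|| [&& a == u, b == v & c == w], [&& a == u, c == v & b == w],
   [&& b == u, c == v & a == w], [&& b == u, a == v & c == w],
   [&& c == u, a == v & b == w] | [&& c == u, b == v & a == w]].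
  apply: contraNT dn0; rewrite !negb_or.
  have nz (x y z : bool) : ~~ [&& x, y & z] -> x%:R * (y%:R * z%:R) = 0 :> F.
    by case: x; case: y; case: z => //= _; rewrite !(mul0r, mulr0).
  case/and5P=> /nz e1 /nz e2 /nz e3 /nz e4 /andP[/nz e5 /nz e6].
  by rewrite !mulrBr e1 e2 e3 e4 e5 e6 !subrr !addr0.
by case/orP: E => [|/or4P[|||/orP[]]] /and3P[/eqP-> /eqP-> /eqP->];
  apply/permP=> q /=; rewrite !addn0; ring.
Qed.
End Realization.

Section TypeB.
Variable F : fieldType.

Definition lfun_horner (V : vectType F) (f : 'End(V)) (p : {poly F}) : 'End(V) :=
  \sum_(i < size p) p`_i *: iter i (comp_lfun f) \1%VF.

Definition is_minpoly (V : vectType F) (f : 'End(V)) (p : {poly F}) : Prop :=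
  [/\ p \is monic, lfun_horner f p = 0
    & forall q, lfun_horner f q = 0 -> p %| q].

Variable L : saa F.

Definition adapted_basis (x y : 'I_5 -> L) : Prop :=
  let v g := gen_val x y g in
  [/\ standard_basis x y,
      [/\ lcs L 5 = (<[v (gX 5)]> + <[v (gX 4)]>)%VS,
          centre L = (lcs L 5 + <[v (gX 3)]>)%VS,
          ucs L 2 = lcs L 4
        & lcs L 4 = (centre L + <[v (gX 2)]>)%VS]
    & [/\ ucs L 3 = lcs L 3,
          lcs L 3 = (lcs L 4 + <[v (gX 1)]> + <[v (gY 1)]>)%VS,
          lcs L 2 = (lcs L 3 + <[v (gY 2)]>)%VS
        & ucs L 4 = (lcs L 3 + <[v (gY 2)]> + <[v (gY 3)]>)%VS]].

(* The complement L^3 :\: L^4 of L^4 in L^3 stands for L^3/L^4: each coset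
   is represented by its unique element in that complement. *)
Definition quo34 : vectType F := subvs_of (lcs L 3 :\: lcs L 4).

(* u + L^4 |-> u z; this is phi for z = y_2 and psi for z = y_3. *)
Definition rmul34 (z : L) : 'Hom(quo34, subvs_of (lcs L 5)) :=
  linfun (vsproj (lcs L 5) \o applyr saa_mul z \o vsval).

Definition tau (x y : 'I_5 -> L) : 'End(subvs_of (lcs L 5)) :=
  let v g := gen_val x y g in
  (rmul34 (v (gY 3)) \o (rmul34 (v (gY 2)))^-1)%VF.

Definition typeB : Prop :=
  exists x y : 'I_5 -> L,
    adapted_basis x y /\
    exists a : F, is_minpoly (tau x y) (('X - a%:P) ^+ 2).

End TypeB.

(* Main.v *)
From HB Require Import structures.
Require Import Defs.
From mathcomp Require Import all_boot all_order all_algebra.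
From mathcomp Require Import ring.

(** Write T(u, v, w) = (uv, w), an alternating trilinear form which, by
    non-degeneracy, carries the same information as the product. An algebra with
    a standard basis is determined by the values of T on triples of basis
    vectors, so two algebras with the same presentation are isomorphic
    ([has_presentation_iso]).

    Existence. The orthogonality of L^(k+1) and Z_k forces
    L^k Z_k = 0 ([mul_lcs_ucs]), which makes most values of T on a basis adapted
    to the central series vanish. Type B says that the two maps
    phi, psi : L^3/L^4 -> L^5 satisfy (psi phi^-1 - a)^2 = 0 but
    psi phi^-1 <> a, so there are u, v in L^3 with
    u y_3 = a u y_2 and v y_3 = a v y_2 + u y_2 ([tau_pencil]). Replacing y_3 by a
    multiple of y_3 - a y_2, taking x_1 = u, y_1 proportional to v, x_4 = x_1 y_2
    and x_5 = y_1 y_2, and adjusting the other vectors to stay symplectic, one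
    gets the pencil x_1 y_2 = x_4, x_1 y_3 = 0, y_1 y_2 = x_5, y_1 y_3 = x_4
    ([adapted_pencil_basis]). Then r = T(x_2, y_4, y_5) is nonzero, as otherwise
    x_2 would be central ([flag_trip_neq0]). The six values of T that are still
    free are killed by adding vectors closer to the centre to x_1, y_1, y_2, y_3
    ([pencil_basis_presentation]).

    Classification. Scaling the basis diagonally multiplies r by any
    nonzero cube ([has_presentation_scale]). Conversely the map
    Q(u, v) = ((uv)u, (uv)v) is preserved by isomorphisms, and in the algebra
    with parameter r it equals r^2 D(u, v)^3 where D(u, v) is the
    determinant of the (y_4, y_5)-coordinates of u and v
    ([double_mul_form_presented]). Evaluating Q on y_4 and y_5 on both sides of an
    isomorphism gives r^2 = s^2 D^3, whence
    s/r = (s/r)^3 / (s/r)^2 = ((s/r) D)^3. *)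

Set Implicit Arguments.
Unset Strict Implicit.
Unset Printing Implicit Defensive.

Import GRing.Theory.
Local Open Scope ring_scope.

(** * The alternating trilinear form *)

Section Triple.
Variables (F : fieldType) (L : saa F).
Implicit Types u v w : L.

Definition trip u v w : F := saa_form (saa_mul u v) w.

Lemma saa_formDl u v w : saa_form (u + v) w = saa_form u w + saa_form v w.
Proof. exact: linearDl. Qed.
Lemma saa_formDr u v w : saa_form w (u + v) = saa_form w u + saa_form w v.
Proof. exact: linearDr. Qed.
Lemma saa_formZl a u w : saa_form (a *: u) w = a * saa_form u w.
Proof. exact: linearZl_LR. Qed.
Lemma saa_formZr a u w : saa_form w (a *: u) = a * saa_form w u.
Proof. exact: linearZr_LR. Qed.
Lemma saa_mulDl u v w : saa_mul (u + v) w = saa_mul u w + saa_mul v w.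
Proof. exact: linearDl. Qed.
Lemma saa_mulDr u v w : saa_mul w (u + v) = saa_mul w u + saa_mul w v.
Proof. exact: linearDr. Qed.
Lemma saa_mulZl a u w : saa_mul (a *: u) w = a *: saa_mul u w.
Proof. exact: linearZl_LR. Qed.
Lemma saa_mulZr a u w : saa_mul w (a *: u) = a *: saa_mul w u.
Proof. exact: linearZr_LR. Qed.

Definition saa_formE := (saa_formDl, saa_formDr, saa_formZl, saa_formZr).
Definition saa_mulE := (saa_mulDl, saa_mulDr, saa_mulZl, saa_mulZr).

Lemma tripE u v w : trip u v w = saa_form (saa_mul u v) w. Proof. by []. Qed.

Lemma saa_form_anti u v : saa_form v u = - saa_form u v.
Proof.
apply/eqP; rewrite -addr_eq0 addrC; apply/eqP.
have := saa_form_alt (u + v).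
by rewrite !saa_formE !saa_form_alt add0r addr0.
Qed.

Lemma saa_mul_anti u v : saa_mul v u = - saa_mul u v.
Proof.
apply/eqP; rewrite -addr_eq0 addrC; apply/eqP.
have := saa_mul_alt (u + v).
by rewrite !saa_mulE !saa_mul_alt add0r addr0.
Qed.

Lemma saa_form_inj u v : (forall w, saa_form u w = saa_form v w) -> u = v.
Proof.
move=> uv; apply/eqP; rewrite -subr_eq0; apply/eqP/saa_form_nondeg => w.
by rewrite linearBl /= uv subrr.
Qed.

Lemma trip_rot u v w : trip u v w = trip v w u.
Proof. exact: saa_form_mulC. Qed.

Lemma trip_swap u v w : trip v u w = - trip u v w.
Proof. by rewrite /trip saa_mul_anti linearNl. Qed.

Lemma trip_swap23 u v w : trip u w v = - trip u v w.
Proof. by rewrite trip_rot trip_swap trip_rot trip_rot. Qed.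

Lemma trip_alt u w : trip u u w = 0.
Proof. by rewrite /trip saa_mul_alt linear0l. Qed.

Lemma trip_alt23 u w : trip w u u = 0.
Proof. by rewrite trip_rot trip_alt. Qed.

End Triple.

(** * Orthogonality of the central series *)

Section CentralSeries.
Variables (F : fieldType) (L : saa F).

Lemma prodsv_orth (A B : {vspace L}) v :
    (forall a b, a \in A -> b \in B -> saa_form (saa_mul a b) v = 0) ->
  forall u, u \in prodsv A B -> saa_form u v = 0.
Proof.
move=> ABv u /(@coord_span _ _ _ (in_tuple _))->.
rewrite linear_sumlz big1 // => i _; rewrite linearZl_LR /=.
have /allpairsP[[a b] /= [aA bB ->]] := mem_nth 0 (ltn_ord i).
by rewrite ABv ?mulr0 ?vbasis_mem.
Qed.

(** Induction on k: (ab, v) = (bv, a), and bv falls one step down the upper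
    central series when v is in Z_k. *)
Lemma lcs_ucs_orth k u v : u \in lcs L k.+1 -> v \in ucs L k -> saa_form u v = 0.
Proof.
elim: k u v => [|k IHk] u v; first by rewrite memv0 => _ /eqP->; rewrite linear0r.
move=> uk /ucsSP vk; move: u uk; apply: prodsv_orth => a b ak _.
by rewrite saa_form_mulC saa_mul_anti linearNl /= saa_form_anti opprK IHk.
Qed.

(** (uv, w) = (vw, u), and vw lies in Z_k, which is orthogonal to L^(k+1). *)
Lemma mul_lcs_ucs k (u v : L) : u \in lcs L k.+1 -> v \in ucs L k.+1 -> saa_mul u v = 0.
Proof.
move=> uk /ucsSP vk; apply: saa_form_inj => w.
by rewrite linear0l saa_form_mulC saa_form_anti (lcs_ucs_orth uk) ?oppr0.
Qed.

Lemma centre_mul (u v : L) : u \in centre L -> saa_mul u v = 0.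
Proof. by move=> uZ; have /ucsSP/(_ v) : u \in ucs L 1 := uZ; rewrite memv0 => /eqP. Qed.

(** What the proof retains of the hypotheses on the two central series. *)
Definition series_facts : Prop :=
  [/\ ucs L 3 = lcs L 3, (lcs L 2 <= ucs L 4)%VS, prodsv (lcs L 3) (lcs L 2) = lcs L 5
    & [/\ (centre L <= lcs L 4)%VS, (lcs L 4 <= lcs L 3)%VS & (lcs L 3 <= lcs L 2)%VS]].

(** The membership half of an adapted basis: unlike the equalities of spans, it
    is visibly preserved when vectors closer to the centre are added. *)
Definition flag_basis (x y : 'I_5 -> L) : Prop :=
  [/\ standard_basis x y,
      [/\ x (inord 4) \in centre L, x (inord 3) \in centre L & x (inord 2) \in centre L],
      x (inord 1) \in lcs L 4,
      x (inord 0) \in lcs L 3 /\ y (inord 0) \in lcs L 3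
    & y (inord 1) \in lcs L 2 /\ y (inord 2) \in ucs L 4].

Hypothesis sf : series_facts.

Lemma mul_L4_Z4 (u v : L) : u \in lcs L 4 -> v \in ucs L 4 -> saa_mul u v = 0.
Proof. exact: mul_lcs_ucs. Qed.

Lemma mul_L3_L3 (u v : L) : u \in lcs L 3 -> v \in lcs L 3 -> saa_mul u v = 0.
Proof. by case: sf => Z3 _ _ _ u3 v3; rewrite (@mul_lcs_ucs 2) // Z3. Qed.

(** This is where L^3 L^2 = L^5 enters: L^5 is orthogonal to Z_4. *)
Lemma trip_L3_L2_Z4 (u v w : L) :
  u \in lcs L 3 -> v \in lcs L 2 -> w \in ucs L 4 -> trip u v w = 0.
Proof.
case: sf => _ _ L5 _ u3 v2; apply: lcs_ucs_orth.
by rewrite -L5; apply: memv_prodsv.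
Qed.

End CentralSeries.

(** * Standard bases *)

Lemma inord5_eq (i j : nat) : (i < 5)%N -> (j < 5)%N ->
  (inord i == inord j :> 'I_5) = (i == j).
Proof. by move=> i5 j5; rewrite -val_eqE /= !inordK. Qed.

Lemma eq_inl (i j : 'I_5) : (inl i == inl j :> gen) = (i == j). Proof. by []. Qed.
Lemma eq_inr (i j : 'I_5) : (inr i == inr j :> gen) = (i == j). Proof. by []. Qed.

Lemma forall_ord5 (P : 'I_5 -> Prop) :
  P (inord 0) -> P (inord 1) -> P (inord 2) -> P (inord 3) -> P (inord 4) ->
  forall i, P i.
Proof.
move=> P0 P1 P2 P3 P4 i; rewrite -(inord_val i).
by case: i => -[|[|[|[|[|//]]]]].
Qed.

Lemma sum_ord5 (V : nmodType) (h : 'I_5 -> V) : \sum_i h i =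
    h (inord 0) + h (inord 1) + h (inord 2) + h (inord 3) + h (inord 4).
Proof.
rewrite !big_ord_recl big_ord0 addr0 !addrA.
by do !congr (_ + _); congr h; apply/val_inj; rewrite /= inordK.
Qed.

Section StandardBasis.
Variables (F : fieldType) (L : saa F).
Implicit Types x y : 'I_5 -> L.

Definition hyperbolic x y : Prop :=
  [/\ forall i j, saa_form (x i) (x j) = 0,
      forall i j, saa_form (y i) (y j) = 0
    & forall i j, saa_form (x i) (y j) = (i == j)%:R].

Definition gen_coord x y (u : L) (g : gen) : F :=
  match g with inl i => saa_form u (y i) | inr i => - saa_form u (x i) end.

Lemma sum_gen (V : nmodType) (h : gen -> V) :
  \sum_g h g = \sum_i h (inl i) + \sum_i h (inr i).
Proof. exact: big_sumType. Qed.

Lemma gen_valK x y (c : gen -> F) : hyperbolic x y ->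
  gen_coord x y (\sum_g c g *: gen_val x y g) =1 c.
Proof.
case=> xx yy xy [] i /=; rewrite linear_sumlz sum_gen /=.
  rewrite (bigD1 i) //= big1 => [|j ji]; last first.
    by rewrite linearZl_LR /= xy (negPf ji) mulr0.
  rewrite big1 => [|j _]; last by rewrite linearZl_LR /= yy mulr0.
  by rewrite linearZl_LR /= xy eqxx mulr1 !addr0.
rewrite big1 => [|j _]; last by rewrite linearZl_LR /= xx mulr0.
rewrite (bigD1 i) //= big1 => [|j ji]; last first.
  by rewrite linearZl_LR /= saa_form_anti xy eq_sym (negPf ji) oppr0 mulr0.
by rewrite linearZl_LR /= saa_form_anti xy eqxx mulrN1 addr0 add0r opprK.
Qed.

(** The coordinates of a combination of the ten vectors can be read off from the
    form, so they are independent. *)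
Lemma hyperbolic_basis x y :
  \dim {:L} = 10 -> hyperbolic x y -> standard_basis x y.
Proof.
move=> dimL xy; case: (xy) => xx yy xy1; split=> //.
pose h (c : {ffun gen -> F^o}) : L := \sum_g c g *: gen_val x y g.
have h_lin : linear h.
  move=> a c d; rewrite /h scaler_sumr -big_split; apply: eq_bigr => g _ /=.
  by rewrite !ffunE scalerDl scalerA.
pose H : 'Hom({ffun gen -> F^o}, L) :=
  linfun (HB.pack_for {linear {ffun gen -> F^o} -> L} h (GRing.isLinear.Build _ _ _ _ h h_lin)).
have HE c : H c = h c by rewrite lfunE.
have kerH : lker H == 0%VS.
  apply/lker0P => c d; rewrite !HE => hcd; apply/ffunP => g.
  by rewrite -(gen_valK c xy g) -(gen_valK d xy g) -/(h c) hcd.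
have imH : limg H = fullv.
  apply/eqP; rewrite eqEdim subvf dimL limg_dim_eq; last first.
    by rewrite (eqP kerH) capv0.
  by rewrite dimvf /dim /= card_sum card_ord.
rewrite basisEdim size_cat !size_codom card_ord dimL andbT -imH.
apply/subvP => _ /memv_imgP[c _ ->]; rewrite HE; apply: memv_suml => g _.
rewrite memvZ // memv_span // mem_cat.
by case: g => i /=; apply/orP; [left|right]; apply: codom_f.
Qed.

Lemma hyperbolic_inord (x y : 'I_5 -> L) : hyperbolic x y ->
  [/\ forall i j, saa_form (x i) (x j) = 0,
      forall i j, saa_form (y i) (y j) = 0,
      forall i j, (i < 5)%N -> (j < 5)%N ->
        saa_form (x (inord i)) (y (inord j)) = (i == j)%:R
    & forall i j, (i < 5)%N -> (j < 5)%N ->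
        saa_form (y (inord j)) (x (inord i)) = - (i == j)%:R].
Proof.
case=> xx yy xy; split=> // i j i5 j5; last rewrite saa_form_anti.
  by rewrite xy inord5_eq.
by rewrite xy inord5_eq.
Qed.

Definition family5 (a b c d e : L) (i : 'I_5) : L := nth 0 [:: a; b; c; d; e] i.

Lemma family5E a b c d e :
  (family5 a b c d e (inord 0) = a) * (family5 a b c d e (inord 1) = b)
  * (family5 a b c d e (inord 2) = c) * (family5 a b c d e (inord 3) = d)
  * (family5 a b c d e (inord 4) = e).
Proof. by rewrite /family5 !inordK. Qed.

Variables (x y : 'I_5 -> L).
Hypothesis sb : standard_basis x y.

Lemma standard_hyperbolic : hyperbolic x y. Proof. by case: sb. Qed.

Lemma standard_basis_dim : \dim {:L} = 10%N.
Proof. by case: sb => /andP[/eqP<- /eqP->] _ _ _; rewrite size_cat !size_codom card_ord. Qed.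

Lemma saa_form_gen0 u : (forall g, saa_form u (gen_val x y g) = 0) -> u = 0.
Proof.
case: sb => /span_basis bas _ _ _ u0; apply: saa_form_nondeg => v.
have /(@coord_span _ _ _ (in_tuple _))-> : v \in <<codom x ++ codom y>>%VS.
  by rewrite bas memvf.
rewrite linear_sumr big1 // => i _; rewrite linearZr_LR /=.
have := mem_nth 0 (ltn_ord i : (i < size (in_tuple (codom x ++ codom y)))%N).
rewrite mem_cat => /orP[] /codomP[j ->]; first by rewrite (u0 (inl j)) mulr0.
by rewrite (u0 (inr j)) mulr0.
Qed.

Lemma gen_coordK u : \sum_g gen_coord x y u g *: gen_val x y g = u.
Proof.
apply/eqP; rewrite -subr_eq0; apply/eqP/saa_form_gen0 => -[] i.
  have /= /oppr_inj e := gen_valK (gen_coord x y u) standard_hyperbolic (inr i).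
  by rewrite linearBl /= e subrr.
have /= e := gen_valK (gen_coord x y u) standard_hyperbolic (inl i).
by rewrite linearBl /= e subrr.
Qed.

End StandardBasis.

(** * Algebras with the same presentation *)

Section SamePresentation.
Variable F : fieldType.

Lemma trip_sum (L : saa F) (c d e : gen -> F) (v : gen -> L) :
  trip (\sum_g c g *: v g) (\sum_g d g *: v g) (\sum_g e g *: v g)
  = \sum_g \sum_k \sum_h c g * (d h * (e k * trip (v g) (v h) (v k))).
Proof.
rewrite /trip !linear_sumlz /=; apply: eq_bigr => g _.
rewrite linear_sumr; apply: eq_bigr => k _.
rewrite linear_sumr linear_sumlz /=; apply: eq_bigr => h _.
by rewrite linearZl_LR linearZr_LR !linearZl_LR linearZr_LR linearZl_LR /=; ring.
Qed.

Variables (L M : saa F) (x y : 'I_5 -> L) (x' y' : 'I_5 -> M).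
Hypotheses (sbL : standard_basis x y) (sbM : standard_basis x' y').

(** The linear map matching the two bases preserves coordinates, hence the form
    and T; it preserves the product because the form is non-degenerate. *)
Lemma standard_basis_iso :
    (forall g h k, trip (gen_val x y g) (gen_val x y h) (gen_val x y k)
       = trip (gen_val x' y' g) (gen_val x' y' h) (gen_val x' y' k)) ->
  saa_iso L M.
Proof.
move=> eqT.
pose f u : M := \sum_g gen_coord x y u g *: gen_val x' y' g.
pose f' u : L := \sum_g gen_coord x' y' u g *: gen_val x y g.
have f_lin : linear f.
  move=> a u v; rewrite /f scaler_sumr -big_split; apply: eq_bigr => g _ /=.
  rewrite scalerA -scalerDl; congr (_ *: _).
  by case: g => i /=; rewrite linearDl linearZl_LR /= ?opprD ?mulrN.
have coordf u : gen_coord x' y' (f u) =1 gen_coord x y u.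
  exact/gen_valK/standard_hyperbolic.
have coordf' u : gen_coord x y (f' u) =1 gen_coord x' y' u.
  exact/gen_valK/standard_hyperbolic.
have fK : cancel f f'.
  move=> u; rewrite -[RHS](gen_coordK sbL); apply: eq_bigr => g _.
  by rewrite coordf.
have f'K : cancel f' f.
  move=> u; rewrite -[RHS](gen_coordK sbM); apply: eq_bigr => g _.
  by rewrite coordf'.
have form_f u v : saa_form (f u) (f v) = saa_form u v.
  rewrite -[in RHS](gen_coordK sbL v) /f !linear_sumr; apply: eq_bigr => g _.
  rewrite !linearZr_LR /=; congr (_ * _).
  have := coordf u; case: g => i e; last exact: (e (inl i)).
  by apply: oppr_inj; exact: (e (inr i)).
have trip_f u v w : trip (f u) (f v) (f w) = trip u v w.
  rewrite -[in RHS](gen_coordK sbL u) -[in RHS](gen_coordK sbL v).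
  rewrite -[in RHS](gen_coordK sbL w) !trip_sum.
  by do 3![apply: eq_bigr => ? _]; rewrite eqT.
exists (linfun (HB.pack_for {linear L -> M} f (GRing.isLinear.Build _ _ _ _ f f_lin))).
split=> [|u v|u v]; last 2 first.
- by rewrite !lfunE.
- rewrite !lfunE /=; apply: saa_form_inj => w; rewrite -(f'K w) form_f.
  by rewrite -[RHS]/(trip _ _ _) trip_f.
by exists f' => u; rewrite lfunE /= ?fK ?f'K.
Qed.

End SamePresentation.

Section Presentations.
Variable F : fieldType.

Lemma perm3_closed (T : eqType) (P : T -> T -> T -> Prop) :
    (forall a b c, P a b c -> P b a c) -> (forall a b c, P a b c -> P a c b) ->
  forall a b c u v w,
    perm_eq [:: u; v; w] [:: a; b; c] -> P a b c -> P u v w.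
Proof.
move=> P12 P23 a b c u v w /(perm_iotaP a)[s]; rewrite -mem_permutations.
have /perm_mem-> : perm_eq (permutations (iota 0 3))
    [:: [:: 0; 1; 2]; [:: 0; 2; 1]; [:: 1; 0; 2];
        [:: 1; 2; 0]; [:: 2; 0; 1]; [:: 2; 1; 0]]%N by [].
by rewrite !inE => /or4P[|||/or3P[]] /eqP-> /= [-> -> ->]; auto.
Qed.

Lemma listed_dec (p : presentation F) u v w : decidable (listed p u v w).
Proof.
apply: (@decP _ (has (fun e => perm_eq [:: u; v; w] [:: e.1.1.1; e.1.1.2; e.1.2]) p)).
exact: hasP.
Qed.

(** A listed entry fixes T on all its permutations, up to the same sign in both
    algebras. *)
Lemma has_presentation_iso (L M : saa F) (p : presentation F) :
  has_presentation L p -> has_presentation M p -> saa_iso L M.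
Proof.
case=> x [y [sbL valL zeroL]] [x' [y' [sbM valM zeroM]]].
apply: (standard_basis_iso sbL sbM) => u v w.
case: (listed_dec p u v w) => [[[[[a b] c] d] ep /=]|nl]; last first.
  by rewrite /trip zeroL ?zeroM.
pose P u v w := trip (gen_val x y u) (gen_val x y v) (gen_val x y w)
  = trip (gen_val x' y' u) (gen_val x' y' v) (gen_val x' y' w).
move/(@perm3_closed _ P); rewrite /P; apply=> [{}u {}v {}w|{}u {}v {}w|].
- by rewrite trip_swap [in RHS]trip_swap => /oppr_inj.
- by rewrite trip_swap23 [in RHS]trip_swap23 => /oppr_inj.
by rewrite /trip (valL _ _ _ _ ep) (valM _ _ _ _ ep).
Qed.

End Presentations.

(** * Isomorphism classes of the algebras in the family *)

Section Invariant.
Variable F : fieldType.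

Definition double_mul_form (L : saa F) (u v : L) : F :=
  saa_form (saa_mul (saa_mul u v) u) (saa_mul (saa_mul u v) v).

Lemma triple_P10_3_7 (r : F) u v w : triple (P10_3_7 r) u v w =
  r * det3 (gX 2) (gY 4) (gY 5) u v w + det3 (gX 1) (gY 2) (gY 4) u v w
  + det3 (gY 1) (gY 2) (gY 5) u v w + det3 (gY 1) (gY 3) (gY 4) u v w.
Proof. by rewrite /triple !big_cons big_nil /= !mul1r addr0 !addrA. Qed.

Lemma deltaE (g h : gen) : delta F g h = (h == g)%:R.
Proof. exact: ffunE. Qed.

Lemma coord_mul_inl (p : presentation F) u v i :
  coord_mul p u v (inl i) = triple p u v (delta F (inr i)).
Proof. exact: ffunE. Qed.

Lemma coord_mul_inr (p : presentation F) u v i :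
  coord_mul p u v (inr i) = - triple p u v (delta F (inl i)).
Proof. exact: ffunE. Qed.

Definition minor (a b : gen) (u v : {ffun gen -> F^o}) : F :=
  u a * v b - u b * v a.

Lemma coord_mul_P10_3_7 (r : F) (u v : {ffun gen -> F^o}) :
  let p := coord_mul (P10_3_7 r) u v in
  [/\ [/\ p (gX 1) = minor (gY 2) (gY 5) u v + minor (gY 3) (gY 4) u v,
          p (gX 2) = minor (gY 4) (gX 1) u v + minor (gY 5) (gY 1) u v
        & p (gX 3) = minor (gY 4) (gY 1) u v],
      [/\ p (gY 1) = - minor (gY 2) (gY 4) u v
        & p (gY 2) = - (r * minor (gY 4) (gY 5) u v)]
    & [/\ p (gY 3) = 0, p (gY 4) = 0 & p (gY 5) = 0]].
Proof.
split; split; rewrite ?coord_mul_inl ?coord_mul_inr triple_P10_3_7 /det3 /minor.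
all: rewrite /gX /gY /= !deltaE ?eq_inl ?eq_inr /= !inord5_eq //=.
all: by ring.
Qed.

(** The product uv has coordinates 0 at y_3, y_4, y_5 and -r D at y_2, with D the
    minor of u, v. The part in L^3 is killed in both factors, as L^3 L lies in
    L^4, which is orthogonal to L^3. What is left is
    r^2 D^2 (y_2 u, y_2 v) = r^2 D^3, as y_2 y_4 = -y_1 and y_2 y_5 = x_1. *)
Lemma double_mul_form_presented (r : F) (u v : presented_saa (P10_3_7 r)) :
  double_mul_form u v = r ^+ 2 * minor (gY 4) (gY 5) u v ^+ 3.
Proof.
rewrite -[LHS]/(let p := coord_mul (P10_3_7 r) u v in
  coord_form (coord_mul (P10_3_7 r) p u) (coord_mul (P10_3_7 r) p v)) /=.
have [_ [_ p2] [p3 p4 p5]] := coord_mul_P10_3_7 r u v.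
move: (coord_mul _ u v) p2 p3 p4 p5 => p p2 p3 p4 p5.
have [[a1 a2 a3] [b1 b2] [b3 b4 b5]] := coord_mul_P10_3_7 r p u.
have [[c1 c2 c3] [d1 d2] [d3 d4 d5]] := coord_mul_P10_3_7 r p v.
move: (coord_mul _ p u) (coord_mul _ p v) a1 a2 a3 b1 b2 b3 b4 b5
   c1 c2 c3 d1 d2 d3 d4 d5 => q t.
rewrite /minor p2 p3 p4 p5 => a1 a2 a3 b1 b2 b3 b4 b5 c1 c2 c3 d1 d2 d3 d4 d5.
rewrite /coord_form sum_ord5 -!/(gX 1) -!/(gX 2) -!/(gX 3) -!/(gX 4) -!/(gX 5).
rewrite -!/(gY 1) -!/(gY 2) -!/(gY 3) -!/(gY 4) -!/(gY 5).
rewrite a1 a2 a3 b1 b2 b3 b4 b5 c1 c2 c3 d1 d2 d3 d4 d5 /minor.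
ring.
Qed.

End Invariant.

Section Classification.
Variable F : fieldType.

Lemma listed_P10_3_7 (r s : F) u v w :
  listed (P10_3_7 r) u v w -> listed (P10_3_7 s) u v w.
Proof.
case=> -[[[a b] c] d]; rewrite !inE => /or4P[] /eqP[-> -> -> ->] perm.
- by exists (gX 2, gY 4, gY 5, s) => //; rewrite !inE eqxx.
- by exists (gX 1, gY 2, gY 4, 1) => //; rewrite !inE eqxx ?orbT.
- by exists (gY 1, gY 2, gY 5, 1) => //; rewrite !inE eqxx ?orbT.
- by exists (gY 1, gY 3, gY 4, 1) => //; rewrite !inE eqxx ?orbT.
Qed.

Lemma has_presentation_scale (L : saa F) (r b : F) : b != 0 ->
  has_presentation L (P10_3_7 r) -> has_presentation L (P10_3_7 (r * b ^+ 3)).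
Proof.
move=> b0 [x [y [sb val zero]]].
(* With weight l_i on x_i and 1 / l_i on y_i, the three unit entries impose
   l_1 = l_2 l_4, l_1 l_2 l_5 = 1 and l_1 l_3 l_4 = 1. Taking l_4 = 1 and
   l_2 = b gives this list, and r is multiplied by l_2 / (l_4 l_5) = b^3. *)
pose l (i : 'I_5) : F := [:: b; b; b^-1; 1; b^-2]`_i.
have l0 i : l i != 0.
  by case: i => -[|[|[|[|[|//]]]]] ?; rewrite /l /= ?invr_eq0 ?expf_neq0 ?oner_neq0.
pose c (g : gen) : F := match g with inl i => l i | inr i => (l i)^-1 end.
pose x' i := l i *: x i; pose y' i := (l i)^-1 *: y i.
have val' g : gen_val x' y' g = c g *: gen_val x y g by case: g.
have trip' u v w : trip (gen_val x' y' u) (gen_val x' y' v) (gen_val x' y' w)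
    = c u * (c v * (c w * trip (gen_val x y u) (gen_val x y v) (gen_val x y w))).
  rewrite !val' /trip linearZr_LR linearZl_LR linearZr_LR !linearZl_LR /=.
  by ring.
exists x', y'; split.
- apply: hyperbolic_basis (standard_basis_dim sb) _.
  case: sb => _ xx yy xy; split=> i j; rewrite linearZl_LR linearZr_LR /=.
  + by rewrite xx !mulr0.
  + by rewrite yy !mulr0.
  rewrite xy; case: eqP => [->|_]; last by rewrite !mulr0.
  by rewrite mulr1 divff.
- move=> u v w d; rewrite -[LHS]/(trip _ _ _) trip'.
  have valr d' : (u, v, w, d') \in P10_3_7 r ->
      trip (gen_val x y u) (gen_val x y v) (gen_val x y w) = d' by exact: val.
  rewrite !inE => /or4P[] /eqP[eu ev ew ->]; first rewrite (valr r);
    rewrite ?(valr 1) ?inE ?eu ?ev ?ew ?eqxx ?orbT //;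
    rewrite /c /gX /gY /l /= !inordK //=; field; rewrite ?b0 ?oner_neq0 //.
- move=> u v w nl; rewrite -[LHS]/(trip _ _ _) trip' /trip zero ?mulr0 //.
  by move/(listed_P10_3_7 (r * b ^+ 3)).
Qed.

Lemma double_mul_form_iso (L M : saa F) (f : 'Hom(L, M)) :
    (forall x y, saa_form (f x) (f y) = saa_form x y) ->
    (forall x y, f (saa_mul x y) = saa_mul (f x) (f y)) ->
  forall u v, double_mul_form (f u) (f v) = double_mul_form u v.
Proof. by move=> ff fm u v; rewrite /double_mul_form -!fm ff. Qed.

Lemma P10_3_7_iso (r s : F) (L M : saa F) : r != 0 -> s != 0 ->
    has_presentation L (P10_3_7 r) -> has_presentation M (P10_3_7 s) ->
  saa_iso L M <-> exists b : F, b != 0 /\ s / r = b ^+ 3.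
Proof.
move=> r0 s0 pL pM; split=> [[f [_ ff fm]]|[b [b0 sr]]]; last first.
  apply: has_presentation_iso pM; have -> : s = r * b ^+ 3 by rewrite -sr; field.
  exact: has_presentation_scale.
have [g [_ gf gm]] := has_presentation_iso (P10_3_7_realized r) pL.
have [h [_ hf hm]] := has_presentation_iso pM (P10_3_7_realized s).
pose u : presented_saa (P10_3_7 r) := delta F (gY 4).
pose v : presented_saa (P10_3_7 r) := delta F (gY 5).
(* The composite of the three isomorphisms goes from the algebra with parameter
   r to the one with parameter s, where the invariant is explicit. *)
have := double_mul_form_iso hf hm (f (g u)) (f (g v)).
rewrite (double_mul_form_iso ff fm) (double_mul_form_iso gf gm) !double_mul_form_presented.
move: (minor _ _ (h _) _) => D.
have -> : minor (gY 4) (gY 5) u v = 1.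
  by rewrite /minor /u /v /gY /= !deltaE !eq_inr !inord5_eq //= mulr0 subr0 mulr1.
rewrite expr1n mulr1 => sr.
have D0 : D != 0.
  apply: contra_eq_neq sr => ->; rewrite expr0n /= mulr0 eq_sym.
  by rewrite expf_neq0.
exists (s / r * D); split; first by rewrite !mulf_neq0 ?invr_eq0.
rewrite exprMn.
have -> : D ^+ 3 = r ^+ 2 / s ^+ 2 by rewrite -sr; field.
by field; rewrite r0 s0.
Qed.

End Classification.

(** * A criterion for the presentation *)

Section SortedTriples.
Variables (F : fieldType) (L : saa F) (x y : 'I_5 -> L).

(** The basis listed from the centre upwards, so that the vanishing of T on a
    triple is governed by its first members. *)
Definition flag_gen (n : nat) : gen :=
  nth (gX 5) [:: gX 5; gX 4; gX 3; gX 2; gX 1; gY 1; gY 2; gY 3; gY 4; gY 5] n.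

Lemma flag_genP (g : gen) : exists2 n, (n < 10)%N & g = flag_gen n.
Proof.
case: g => i; elim/forall_ord5: i.
- by exists 4%N.
- by exists 3%N.
- by exists 2%N.
- by exists 1%N.
- by exists 0%N.
- by exists 5%N.
- by exists 6%N.
- by exists 7%N.
- by exists 8%N.
- by exists 9%N.
Qed.

Lemma top_pair j k : (7 < j)%N -> (j < k)%N -> (k < 10)%N -> j = 8%N /\ k = 9%N.
Proof.
move=> j7 jk k10; split; apply/eqP; rewrite eqn_leq.
  by rewrite j7 andbT -ltnS (leq_trans jk).
by rewrite -ltnS k10 (leq_ltn_trans j7).
Qed.

(** T is alternating, so it is enough to inspect the triples of distinct basis
    vectors in one fixed order. *)
Lemma sorted_presentation (p : presentation F) : standard_basis x y ->
    (forall u v w c, (u, v, w, c) \in p ->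
      trip (gen_val x y u) (gen_val x y v) (gen_val x y w) = c) ->
    (forall i j k, (i < j < k)%N -> (k < 10)%N ->
      let u := flag_gen i in let v := flag_gen j in let w := flag_gen k in
      listed p u v w \/ trip (gen_val x y u) (gen_val x y v) (gen_val x y w) = 0) ->
  has_presentation L p.
Proof.
move=> sb val H; exists x, y; split=> // u v w.
pose P u v w := ~ listed p u v w ->
  trip (gen_val x y u) (gen_val x y v) (gen_val x y w) = 0.
have P12 a b c : P a b c -> P b a c.
  move=> abc nl; rewrite trip_swap abc ?oppr0 // => -[e ep per]; case: nl.
  by exists e => //; rewrite -(permPr per); apply/permP => q /=; rewrite addnCA.
have P23 a b c : P a b c -> P a c b.
  move=> abc nl; rewrite trip_swap23 abc ?oppr0 // => -[e ep per]; case: nl.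
  by exists e => //; rewrite -(permPr per); apply/permP => q /=; congr addn; rewrite addnCA.
rewrite -/(P u v w).
have Peq a b : P a a b by move=> _; rewrite trip_alt.
have Plt i j k : (i < j < k)%N -> (k < 10)%N -> P (flag_gen i) (flag_gen j) (flag_gen k).
  by move=> ijk k10 nl; have [/nl|] := H i j k ijk k10.
have [[i i10 ->] [j j10 ->] [k k10 ->]] :=
  And3 (flag_genP u) (flag_genP v) (flag_genP w).
case: (ltngtP i j) => [ij|ij|<-]; last exact: Peq.
  case: (ltngtP j k) => [jk|jk|<-]; last by apply/P12/P23.
    by apply: Plt; rewrite ?ij.
  case: (ltngtP i k) => [ik|ik|<-]; last by apply: P23.
    by apply/P23/Plt; rewrite ?ik.
  by apply/P23/P12/Plt; rewrite ?ik.
case: (ltngtP i k) => [ik|ik|<-]; last by apply: P23; apply: P12.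
  by apply/P12/Plt; rewrite ?ij.
case: (ltngtP j k) => [jk|jk|<-]; last by apply/P12/P23.
  by apply/P12/P23/Plt; rewrite ?jk.
by apply/P12/P23/P12/Plt; rewrite ?jk.
Qed.

End SortedTriples.

Section Criterion.
Variables (F : fieldType) (L : saa F) (x y : 'I_5 -> L).
Hypotheses (sf : series_facts L) (fb : flag_basis x y).

Local Notation x1 := (x (inord 0)).
Local Notation x2 := (x (inord 1)).
Local Notation x3 := (x (inord 2)).
Local Notation x4 := (x (inord 3)).
Local Notation x5 := (x (inord 4)).
Local Notation y1 := (y (inord 0)).
Local Notation y2 := (y (inord 1)).
Local Notation y3 := (y (inord 2)).
Local Notation y4 := (y (inord 3)).
Local Notation y5 := (y (inord 4)).

(** As L^4 Z_4 = 0, this is up to sign the only value of T on basis vectors that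
    involves x_2. If it were 0, x_2 would be central, hence orthogonal
    to L^2, which contains y_2. *)
Lemma flag_trip_neq0 : trip x2 y4 y5 != 0.
Proof.
have [sb [x5Z x4Z x3Z] x2L4 [x1L3 y1L3] [y2L2 y3Z4]] := fb.
have [Z3 /subvP L2Z4 L5 [/subvP ZL4 /subvP L4L3 /subvP L3L2]] := sf.
have [xx yy xy yx] := hyperbolic_inord (standard_hyperbolic sb).
apply/eqP => t0.
have genP g : [\/ gen_val x y g \in ucs L 4, g = gY 4 | g = gY 5].
  by case: g => i; elim/forall_ord5: i; do ?[by apply: Or31; auto];
    [apply: Or32 | apply: Or33].
have trip0 g h : trip x2 (gen_val x y g) (gen_val x y h) = 0.
  have x2Z4 u v : u \in ucs L 4 -> trip x2 u v = 0.
    by move=> uZ4; rewrite tripE (mul_L4_Z4 x2L4 uZ4) linear0l.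
  case: (genP g) => [gZ4|->|->]; first exact: x2Z4.
    case: (genP h) => [hZ4|->|->]; last exact: t0.
      by rewrite trip_swap23 x2Z4 ?oppr0.
    exact: trip_alt23.
  case: (genP h) => [hZ4|->|->]; last exact: trip_alt23.
    by rewrite trip_swap23 x2Z4 ?oppr0.
  by rewrite trip_swap23 -[RHS]oppr0 -t0.
have x2Z : x2 \in ucs L 1.
  apply/ucsSP => v; rewrite memv0; apply/eqP/(saa_form_gen0 sb) => h.
  rewrite -[LHS]/(trip _ _ _) trip_swap23 tripE.
  have -> : saa_mul x2 (gen_val x y h) = 0 by apply/(saa_form_gen0 sb)/(trip0 h).
  by rewrite linear0l oppr0.
have := lcs_ucs_orth y2L2 x2Z.
by rewrite yx //= => /eqP; rewrite oppr_eq0 oner_eq0.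
Qed.

(** The maps u |-> u y_2 and u |-> u y_3 from L^3/L^4 to L^5 are the identity
    matrix and a nilpotent Jordan block in the bases x_1, y_1 and x_4, x_5. *)
Definition pencil_basis : Prop :=
  [/\ saa_mul x1 y2 = x4, saa_mul x1 y3 = 0, saa_mul y1 y2 = x5 & saa_mul y1 y3 = x4].

(** The remaining triples vanish because Z L = 0, L^4 Z_4 = 0, L^3 L^3 = 0 and
    T(L^3, L^2, Z_4) = 0. *)
Lemma reduced_pencil_presentation r : pencil_basis ->
    trip x2 y4 y5 = r -> trip x1 y4 y5 = 0 -> trip y1 y4 y5 = 0 ->
    trip y2 y3 y4 = 0 -> trip y2 y3 y5 = 0 -> trip y2 y4 y5 = 0 ->
    trip y3 y4 y5 = 0 ->
  has_presentation L (P10_3_7 r).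
Proof.
case=> x12 x13 y12 y13 t2 tx1 ty1 t234 t235 t245 t345.
case: fb => sb [x5Z x4Z x3Z] x2L4 [x1L3 y1L3] [y2L2 y3Z4].
case: (sf) => Z3 L2Z4 L5 [ZL4 L4L3 L3L2].
have L3Z4 u : u \in lcs L 3 -> u \in ucs L 4.
  by move/(subvP L3L2)/(subvP L2Z4).
have y2Z4 : y2 \in ucs L 4 by apply: (subvP L2Z4).
have [_ xx yy xy] := sb.
have xyE i j : (i < 5)%N -> (j < 5)%N ->
    saa_form (x (inord i)) (y (inord j)) = (i == j)%:R.
  by move=> i5 j5; rewrite xy inord5_eq.
have x2_Z4 u v : u \in ucs L 4 -> trip x2 u v = 0.
  by move=> uZ4; rewrite /trip (mul_L4_Z4 x2L4 uZ4) linear0l.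
apply: (sorted_presentation sb).
  move=> u v w c; rewrite !inE => /or4P[] /eqP[-> -> -> ->]; first exact: t2.
  - by rewrite /trip /= x12 xyE.
  - by rewrite /trip /= y12 xyE.
  - by rewrite /trip /= y13 xyE.
have mem e : e \in P10_3_7 r -> listed (P10_3_7 r) e.1.1.1 e.1.1.2 e.1.2.
  by exists e.
(* Positions 0 to 2 are central, 3 is x_2, 4 and 5 are x_1 and y_1, and 6 to 9
   are y_2 to y_5. *)
case=> [|[|[|[|[|[|[|[|i]]]]]]]] j k /andP[ij jk] k10.
1-3: by right; rewrite /trip centre_mul ?linear0l.
- have [j8|j8] := ltnP j 8; last first.
    have [-> ->] := top_pair j8 jk k10.
    by left; apply: (mem (_, _, _, r)); rewrite !inE eqxx.
  right; apply: x2_Z4; move: j ij j8 {jk}.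
  by case=> [|[|[|[|[|[|[|[|j]]]]]]]] // _ _; rewrite ?L3Z4.
- have [j8|j8] := ltnP j 8; last first.
    have [-> ->] := top_pair j8 jk k10.
    by right.
  case: j ij jk j8 => [|[|[|[|[|[|[|[|j]]]]]]]] // _ jk _.
  + by right; rewrite /trip mul_L3_L3 ?linear0l.
  + case: k jk k10 => [|[|[|[|[|[|[|[|[|[|k]]]]]]]]]] // _ _.
    * by right; apply: trip_L3_L2_Z4.
    * by left; apply: (mem (_, _, _, 1)); rewrite !inE eqxx ?orbT.
    * by right; rewrite /trip x12 xyE.
  + by right; rewrite /trip x13 linear0l.
- have [j8|j8] := ltnP j 8; last first.
    have [-> ->] := top_pair j8 jk k10.
    by right.
  case: j ij jk j8 => [|[|[|[|[|[|[|[|j]]]]]]]] // _ jk _.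
  + case: k jk k10 => [|[|[|[|[|[|[|[|[|[|k]]]]]]]]]] // _ _.
    * by right; apply: trip_L3_L2_Z4.
    * by right; rewrite /trip y12 xyE.
    * by left; apply: (mem (_, _, _, 1)); rewrite !inE eqxx ?orbT.
  + case: k jk k10 => [|[|[|[|[|[|[|[|[|[|k]]]]]]]]]] // _ _.
    * by left; apply: (mem (_, _, _, 1)); rewrite !inE eqxx ?orbT.
    * by right; rewrite /trip y13 xyE.
- have [j8|j8] := ltnP j 8; last first.
    have [-> ->] := top_pair j8 jk k10.
    by right.
  case: j ij jk j8 => [|[|[|[|[|[|[|[|j]]]]]]]] // _ jk _.
  by case: k jk k10 => [|[|[|[|[|[|[|[|[|[|k]]]]]]]]]] // _ _; right.
- by have [-> ->] := top_pair ij jk k10; right.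
- have j8 : (8 < j)%N by exact: leq_ltn_trans ij.
  by have [ej _] := top_pair (ltnW j8) jk k10; rewrite ej in j8.
Qed.

End Criterion.

(** * Clearing the remaining values *)

Section Reduction.
Variables (F : fieldType) (L : saa F) (x y : 'I_5 -> L).

Local Notation x1 := (x (inord 0)).
Local Notation x2 := (x (inord 1)).
Local Notation x3 := (x (inord 2)).
Local Notation x4 := (x (inord 3)).
Local Notation x5 := (x (inord 4)).
Local Notation y1 := (y (inord 0)).
Local Notation y2 := (y (inord 1)).
Local Notation y3 := (y (inord 2)).
Local Notation y4 := (y (inord 3)).
Local Notation y5 := (y (inord 4)).

(** Adding multiples of x_2 to x_1, y_1, y_2, y_3 shifts T(-, y_4, y_5) by multiples
    of r, which clears four values. Adding multiples of x_1 and y_1 to y_3 changes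
    y_2 y_3 by any element of L^5, which clears T(y_2, y_3, y_4) and
    T(y_2, y_3, y_5). *)
Lemma pencil_basis_presentation :
    series_facts L -> flag_basis x y -> pencil_basis x y -> trip x2 y4 y5 != 0 ->
  has_presentation L (P10_3_7 (trip x2 y4 y5)).
Proof.
move=> sf fb [x12 x13 y12 y13].
case: (fb) => sb [x5Z x4Z x3Z] x2L4 [x1L3 y1L3] [y2L2 y3Z4].
case: (sf) => Z3 L2Z4 L5 [ZL4 L4L3 L3L2].
have L3Z4 u : u \in lcs L 3 -> u \in ucs L 4.
  by move/(subvP L3L2)/(subvP L2Z4).
have y2Z4 : y2 \in ucs L 4 by apply: (subvP L2Z4).
have [xx yy xy yx] := hyperbolic_inord (standard_hyperbolic sb).
set r := trip x2 y4 y5 => r0.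
pose e1 := trip x1 y4 y5; pose e2 := trip y1 y4 y5.
pose f := trip y2 y4 y5; pose g := trip y3 y4 y5.
(* The multiples of y_1, x_1 in y_2' and of x_3 in x_1', y_1', y_2' restore the
   symplectic relations. The multiple of y_1 also shifts T(y_2, y_3, y_4) by
   e1 / r, whence the value of a. *)
pose a := trip y2 y3 y4 + e1 / r; pose b := trip y2 y3 y5.
pose kap := - (g + a * e1 + b * e2) / r.
pose lam := kap + e1 / r * a + e2 / r * b.
pose x1' := x1 + (- (e1 / r)) *: x2 + (- b) *: x3.
pose y1' := y1 + (- (e2 / r)) *: x2 + a *: x3.
pose y2' := y2 + (e1 / r) *: y1 + (- (e2 / r)) *: x1 + (- (f / r)) *: x2 + lam *: x3.
pose y3' := y3 + a *: x1 + b *: y1 + kap *: x2.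
pose x' := family5 x1' x2 x3 x4 x5; pose y' := family5 y1' y2' y3' y4 y5.
have hyp' : hyperbolic x' y'.
  split; elim/forall_ord5; elim/forall_ord5; rewrite /x' /y' !family5E;
    rewrite ?xx ?yy ?xy //= ?inord5_eq // /x1' /y1' /y2' /y3' ?saa_formE;
    rewrite ?xx ?yy ?xy ?yx //= /lam; ring.
have sb' := hyperbolic_basis (standard_basis_dim sb) hyp'.
have L4mul u v : u \in lcs L 4 -> v \in ucs L 4 -> saa_mul u v = 0.
  exact: mul_L4_Z4.
have L3mul u v : u \in lcs L 3 -> v \in lcs L 3 -> saa_mul u v = 0.
  exact: mul_L3_L3.
have x3m v : saa_mul x3 v = 0 by exact: centre_mul.
have mx3 v : saa_mul v x3 = 0 by rewrite saa_mul_anti x3m oppr0.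
have x2m v : v \in ucs L 4 -> saa_mul x2 v = 0 by exact: L4mul.
have mx2 v : v \in ucs L 4 -> saa_mul v x2 = 0.
  by move=> vZ4; rewrite saa_mul_anti x2m ?oppr0.
have x2L3 : x2 \in lcs L 3 by apply: (subvP L4L3).
have x3L4 : x3 \in lcs L 4 by apply: (subvP ZL4).
have x3L3 : x3 \in lcs L 3 by apply: (subvP L4L3).
have x1'L3 : x1' \in lcs L 3 by rewrite !memvD ?memvZ.
have y1'L3 : y1' \in lcs L 3 by rewrite !memvD ?memvZ.
have y2'L2 : y2' \in lcs L 2.
  by rewrite !memvD ?memvZ //; apply: (subvP L3L2).
have y3'Z4 : y3' \in ucs L 4.
  by rewrite !memvD ?memvZ //; apply: L3Z4.
have fb' : flag_basis x' y' by rewrite /flag_basis /x' /y' !family5E.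
have L33 : (saa_mul x1 x1 = 0) * (saa_mul x1 y1 = 0) * (saa_mul y1 x1 = 0)
    * (saa_mul y1 y1 = 0) by do !split; apply: L3mul.
have L4Z4 : [/\ x1 \in ucs L 4, y1 \in ucs L 4 & x2 \in ucs L 4] by split; apply: L3Z4.
have x2E : (saa_mul x2 x1 = 0) * (saa_mul x2 y1 = 0) * (saa_mul x2 y2 = 0)
    * (saa_mul x2 y3 = 0) * (saa_mul x2 x2 = 0).
  by case: L4Z4 => *; do !split; apply: x2m.
have Ex2 : (saa_mul x1 x2 = 0) * (saa_mul y1 x2 = 0) * (saa_mul y2 x2 = 0).
  by case: L4Z4 => *; do !split; apply: mx2.
have mulE := (saa_mulE, x3m, mx3, x2E, Ex2, L33, scaler0, addr0).
have pb' : pencil_basis x' y'.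
  rewrite /pencil_basis /x' /y' !family5E /x1' /y1' /y2' /y3' !mulE.
  by rewrite x12 x13 y12 y13.
have y23 : saa_mul y2' y3' = saa_mul y2 y3 + (- a) *: x4 + (- b) *: x5 + (e1 / r) *: x4.
  rewrite /y2' /y3' !mulE x13 y13.
  rewrite (saa_mul_anti x1 y2) (saa_mul_anti y1 y2) x12 y12 !mulE.
  by rewrite !scalerN !scaleNr.
have tripDl u v w z : trip (u + v) w z = trip u w z + trip v w z.
  by rewrite !tripE saa_mulE saa_formE.
have tripZl c u w z : trip (c *: u) w z = c * trip u w z.
  by rewrite !tripE saa_mulE saa_formE.
have t3 v w : trip x3 v w = 0 by rewrite tripE x3m linear0l.
rewrite -/r; apply: (reduced_pencil_presentation sf fb' pb'); rewrite /x' /y' !family5E //.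
- by rewrite !(tripDl, tripZl) t3 -/e1 -/r; field.
- by rewrite !(tripDl, tripZl) t3 -/e2 -/r; field.
- rewrite tripE y23 !saa_formE !xy //= -tripE /a; ring.
- rewrite tripE y23 !saa_formE !xy //= -tripE /b; ring.
- by rewrite !(tripDl, tripZl) t3 -/e1 -/e2 -/r -/f; field.
- by rewrite !(tripDl, tripZl) -/e1 -/e2 -/r -/g /kap; field.
Qed.

End Reduction.

(** * The pencil of an algebra of type B *)

Section Horner.
Variables (F : fieldType) (V : vectType F) (t : 'End(V)) (a : F).

Lemma lfun_horner_XsubC w : lfun_horner t ('X - a%:P) w = t w - a *: w.
Proof.
rewrite /lfun_horner size_XsubC !big_ord_recl big_ord0 addr0 /= !coefE /=.
by rewrite add_lfunE !scale_lfunE comp_lfunE !id_lfunE sub0r subr0 scale1r scaleNr addrC.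
Qed.

Lemma lfun_horner_sqr_XsubC w :
  lfun_horner t (('X - a%:P) ^+ 2) w = (t (t w) - a *: t w) - a *: (t w - a *: w).
Proof.
rewrite /lfun_horner size_exp_XsubC !big_ord_recl big_ord0 addr0 /=.
rewrite sqrrB -polyC_exp.
rewrite !coefE /= !add_lfunE !scale_lfunE !comp_lfunE !id_lfunE.
rewrite !mul0r !mul1r !mul0rn !subr0 !addr0 sub0r add0r.
rewrite scalerBr scalerA -expr2 opprB [RHS]addrC mulr2n opprD scalerDl !scaleNr.
by rewrite scale1r -!addrA; do 2!congr (_ + _); rewrite addrC.
Qed.

(** The operator t - a is nonzero with square 0; u is a nonzero value of it. *)
Lemma minpoly_sqr_chain : is_minpoly t (('X - a%:P) ^+ 2) ->
  exists v u : V, [/\ u != 0, t v = a *: v + u & t u = a *: u].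
Proof.
case=> _ sq0 minp.
have tn0 : lfun_horner t ('X - a%:P) != 0.
  apply/eqP=> /minp/dvdp_leq.
  by rewrite size_exp_XsubC size_XsubC polyXsubC_eq0 => /(_ isT).
have : vpick (limg (lfun_horner t ('X - a%:P))) != 0.
  rewrite vpick0 -lkerE; apply: contra tn0 => /subvP ker; apply/eqP/lfunP => v.
  by apply/eqP; rewrite zero_lfunE -memv_ker ker ?memvf.
have /memv_imgP[v _ ->] := memv_pick (limg (lfun_horner t ('X - a%:P))).
rewrite lfun_horner_XsubC => tv; exists v, (t v - a *: v); split=> //.
  by rewrite addrC subrK.
apply/eqP; have -> : t (t v - a *: v) = t (t v) - a *: t v.
  by rewrite linearB linearZ.
by rewrite -subr_eq0 -lfun_horner_sqr_XsubC sq0 zero_lfunE.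
Qed.

End Horner.

Section Adapted.
Variables (F : fieldType) (L : saa F) (x y : 'I_5 -> L).
Hypotheses (ab : adapted_basis x y) (L5 : prodsv (lcs L 3) (lcs L 2) = lcs L 5).

Local Notation x1 := (x (inord 0)).
Local Notation x2 := (x (inord 1)).
Local Notation x3 := (x (inord 2)).
Local Notation x4 := (x (inord 3)).
Local Notation x5 := (x (inord 4)).
Local Notation y1 := (y (inord 0)).
Local Notation y2 := (y (inord 1)).
Local Notation y3 := (y (inord 2)).
Local Notation y4 := (y (inord 3)).
Local Notation y5 := (y (inord 4)).

Lemma adapted_series_facts : series_facts L.
Proof.
case: ab => _ [E5 EZ _ E4] [Z3 E3 E2 Z4].
have L2Z4 : (lcs L 2 <= ucs L 4)%VS by rewrite E2 Z4 addvSl.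
have ZL4 : (centre L <= lcs L 4)%VS by rewrite E4 addvSl.
have L4L3 : (lcs L 4 <= lcs L 3)%VS by rewrite E3 -addvA addvSl.
have L3L2 : (lcs L 3 <= lcs L 2)%VS by rewrite E2 addvSl.
by [].
Qed.

Lemma adapted_flag_basis : flag_basis x y.
Proof.
case: ab => sb [E5 EZ Z2 E4] [Z3 E3 E2 Z4]; split=> //.
- split; rewrite EZ.
  + by rewrite E5 (subvP (addvSl _ _)) // (subvP (addvSl _ _)) // memv_line.
  + by rewrite E5 (subvP (addvSl _ _)) // (subvP (addvSr _ _)) // memv_line.
  + by rewrite (subvP (addvSr _ _)) // memv_line.
- by rewrite E4 (subvP (addvSr _ _)) // memv_line.
- split; rewrite E3.
  + by rewrite (subvP (addvSl _ _)) // (subvP (addvSr _ _)) // memv_line.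
  + by rewrite (subvP (addvSr _ _)) // memv_line.
split; first by rewrite E2 (subvP (addvSr _ _)) // memv_line.
by rewrite Z4 (subvP (addvSr _ _)) // memv_line.
Qed.

Let sf := adapted_series_facts.
Let fb := adapted_flag_basis.

Lemma L5_coord w : w \in lcs L 5 -> exists p q : F, w = p *: x4 + q *: x5.
Proof.
case: ab => _ [-> _ _ _] _ /memv_addP[_ /vlineP[q ->] [_ /vlineP[p ->] ->]].
by exists p, q; rewrite addrC.
Qed.

Lemma L3_coord u : u \in lcs L 3 ->
  exists p q : F, exists2 z, z \in lcs L 4 & u = p *: x1 + q *: y1 + z.
Proof.
case: ab => _ _ [_ -> _ _] /memv_addP[v + [_ /vlineP[q ->] ->]].
move=> /memv_addP[z zL4 [_ /vlineP[p ->] ->]].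
by exists p, q, z; rewrite // -addrA addrC.
Qed.

Lemma adapted_Z4 : [/\ y2 \in ucs L 4, y3 \in ucs L 4
   & forall z v, z \in lcs L 4 -> v \in ucs L 4 -> saa_mul z v = 0].
Proof.
case: fb => _ _ _ _ [y2L2 y3Z4]; case: (sf) => _ /subvP L2Z4 _ _.
by split=> //; [apply: L2Z4 | move=> z v; apply: mul_L4_Z4].
Qed.

Lemma mul_L3_y2 u : u \in lcs L 3 -> saa_mul u y2 \in lcs L 5.
Proof. by case: fb => _ _ _ _ [y2L2 _] uL3; rewrite -L5 memv_prodsv. Qed.

(** A priori the product lies in Z_2, spanned by x_2, ..., x_5; it is orthogonal
    to y_2 because L^3 L^2 is orthogonal to Z_4, and to y_3 because T is
    alternating. *)
Lemma mul_L3_y3 u : u \in lcs L 3 -> saa_mul u y3 \in lcs L 5.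
Proof.
move=> uL3; have [y2Z4 y3Z4 _] := adapted_Z4.
case: (fb) => sb _ _ _ [y2L2 _].
have [xx yy xy yx] := hyperbolic_inord (standard_hyperbolic sb).
have uy2 : saa_form (saa_mul u y3) y2 = 0.
  by rewrite -[LHS]/(trip _ _ _) trip_swap23 (trip_L3_L2_Z4 sf) ?oppr0.
have uy3 : saa_form (saa_mul u y3) y3 = 0.
  by rewrite -[LHS]/(trip _ _ _) trip_alt23.
have : saa_mul u y3 \in ucs L 2.
  by case: (sf) uL3 => Z3 _ _ _; rewrite -Z3 => /ucsSP.
case: (ab) => _ [_ EZ -> ->] _; rewrite EZ.
move=> /memv_addP[_ /memv_addP[w wL5 [_ /vlineP[c ->] ->]] [_ /vlineP[d ->] e]].
have [p [q ew]] := L5_coord wL5.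
move: uy2 uy3; rewrite e {1 2}ew !saa_formE !xy //=.
rewrite !(mulr0, mulr1, addr0, add0r) => -> ->.
by rewrite !scale0r !addr0.
Qed.

Lemma L5_rmul_y2 w : w \in lcs L 5 -> exists2 u, u \in lcs L 3 & w = saa_mul u y2.
Proof.
case: (ab) => _ _ [_ _ E2 _].
suff /subvP sub : (lcs L 5 <= linfun (applyr saa_mul y2) @: lcs L 3)%VS.
  by move=> /sub/memv_imgP[u uL3 ->]; exists u; rewrite ?lfunE.
rewrite -L5; apply/prodsvP => u b uL3; rewrite E2.
move=> /memv_addP[v vL3 [_ /vlineP[c ->] ->]].
rewrite !saa_mulE (mul_L3_L3 sf) // add0r -saa_mulZl.
by apply/memv_imgP; exists (c *: u); rewrite ?memvZ ?lfunE.
Qed.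

Lemma rmul34E z (q : quo34 L) : saa_mul (vsval q) z \in lcs L 5 ->
  vsval (rmul34 z q) = saa_mul (vsval q) z.
Proof. by move=> qz; rewrite lfunE /= vsprojK. Qed.

Lemma quo34_L3 (q : quo34 L) : vsval q \in lcs L 3.
Proof. exact: subvP (diffvSl _ _) _ (subvsP q). Qed.

Lemma rmul34_y2_surj (w : subvs_of (lcs L 5)) : exists q, rmul34 y2 q = w.
Proof.
have [u] := L5_rmul_y2 (subvsP w).
rewrite -(addv_diff_cap (lcs L 3) (lcs L 4)) => /memv_addP[q qL [z + ->]].
rewrite memv_cap => /andP[_ zL4] wE.
exists (vsproj (lcs L 3 :\: lcs L 4) q); apply: val_inj.
have [y2Z4 _ mul0] := adapted_Z4.
rewrite /= rmul34E vsprojK ?mul_L3_y2 ?(subvP (diffvSl _ _) _ qL) //.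
by rewrite [RHS]wE saa_mulDl (mul0 z) ?addr0.
Qed.

(** Read through phi, an eigenvector of tau and a preimage of it under tau - a
    become elements of L^3. *)
Lemma tau_pencil a : is_minpoly (tau x y) (('X - a%:P) ^+ 2) ->
  exists u v, [/\ u \in lcs L 3, v \in lcs L 3, saa_mul u y2 != 0,
    saa_mul u y3 = a *: saa_mul u y2
    & saa_mul v y3 = a *: saa_mul v y2 + saa_mul u y2].
Proof.
move=> /minpoly_sqr_chain[w [n [n0 tw tn]]].
pose phi := rmul34 y2; pose psi := rmul34 y3.
have phiK z : phi (phi^-1%VF z) = z.
  apply: limg_lfunVK; have [q <-] := rmul34_y2_surj z; exact: memv_img (memvf q).
have tauE z : tau x y z = psi (phi^-1%VF z) by rewrite /tau comp_lfunE.
have phiE q : vsval (phi q) = saa_mul (vsval q) y2.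
  by rewrite rmul34E ?mul_L3_y2 ?quo34_L3.
have psiE q : vsval (psi q) = saa_mul (vsval q) y3.
  by rewrite rmul34E ?mul_L3_y3 ?quo34_L3.
exists (vsval (phi^-1%VF n)), (vsval (phi^-1%VF w)).
rewrite -!phiE -!psiE !phiK -!tauE tw tn !quo34_L3.
by split=> //; rewrite ?linearD ?linearZ.
Qed.

(** Modulo L^4, u and v form a basis of L^3; up to L^4 the new x_1 and y_1 are u
    and v / (u, v). *)
Lemma adapted_pencil_basis a u v :
    u \in lcs L 3 -> v \in lcs L 3 -> saa_mul u y2 != 0 ->
    saa_mul u y3 = a *: saa_mul u y2 ->
    saa_mul v y3 = a *: saa_mul v y2 + saa_mul u y2 ->
  exists x' y' : 'I_5 -> L, flag_basis x' y' /\ pencil_basis x' y'.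
Proof.
move=> uL3 vL3 un0 uy3 vy3.
have [sb [x5Z x4Z x3Z] x2L4 [x1L3 y1L3] [y2L2 y3Z4]] := fb.
have [xx yy xy yx] := hyperbolic_inord (standard_hyperbolic sb).
have [y2Z4 _ L4mul] := adapted_Z4.
have [al [be [z zL4 eu]]] := L3_coord uL3.
have [ga [de [z' z'L4 ev]]] := L3_coord vL3.
have ry2 p q t : t \in lcs L 4 ->
    saa_mul (p *: x1 + q *: y1 + t) y2 = p *: saa_mul x1 y2 + q *: saa_mul y1 y2.
  by move=> tL4; rewrite !saa_mulE (L4mul t) ?addr0.
have ry3 p q t : t \in lcs L 4 ->
    saa_mul (p *: x1 + q *: y1 + t) y3 = p *: saa_mul x1 y3 + q *: saa_mul y1 y3.
  by move=> tL4; rewrite !saa_mulE (L4mul t) ?addr0.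
move: un0 uy3 vy3; rewrite eu ev !ry2 // !ry3 //.
set A := saa_mul x1 y2; set B := saa_mul y1 y2.
set C := saa_mul x1 y3; set E := saa_mul y1 y3 => n0 eqC eqE.
pose d := al * de - be * ga.
(* d is (u, v). If d = 0, then u and v are dependent modulo L^4, and the two
   equations give al * n = be * n = 0 for n = u y_2, hence n = 0. *)
have d0 : d != 0.
  apply: contra_neq n0 => d0; apply: saa_form_nondeg => w.
  have := congr1 (saa_form^~ w) eqC; have := congr1 (saa_form^~ w) eqE.
  rewrite !saa_formE; move: (saa_form A w) (saa_form B w) => A' B'.
  move: (saa_form C w) (saa_form E w) => C' E' eE eC.
  apply/eqP; rewrite -sqrf_eq0; apply/eqP.
  have aln : al * (al * A' + be * B') = d * (E' - a * B').
    transitivity (al * (ga * C' + de * E') - al * (a * (ga * A' + de * B'))).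
      by rewrite eE; ring.
    transitivity (ga * (al * C' + be * E') + d * E' - al * (a * (ga * A' + de * B'))).
      by rewrite /d; ring.
    by rewrite eC /d; ring.
  have ben : be * (al * A' + be * B') = - d * (C' - a * A').
    transitivity (be * (ga * C' + de * E') - be * (a * (ga * A' + de * B'))).
      by rewrite eE; ring.
    transitivity (de * (al * C' + be * E') - d * C' - be * (a * (ga * A' + de * B'))).
      by rewrite /d; ring.
    by rewrite eC /d; ring.
  rewrite expr2 {1}mulrDl -!mulrA ![A' * _]mulrC ![B' * _]mulrC !mulrA aln ben d0.
  by ring.
have [A4 [A5 eA]] := L5_coord (mul_L3_y2 x1L3).
have [B4 [B5 eB]] := L5_coord (mul_L3_y2 y1L3).
rewrite -/A -/B in eA eB.
pose D := A4 * B5 - A5 * B4.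
have [x4L5 x5L5] : x4 \in lcs L 5 /\ x5 \in lcs L 5.
  case: ab => _ [-> _ _ _] _.
  by split; [rewrite (subvP (addvSr _ _)) ?memv_line|rewrite (subvP (addvSl _ _)) ?memv_line].
(* D is the determinant of u |-> u y_2 from L^3/L^4 onto L^5. *)
have D0 : D != 0.
  have img w : w \in lcs L 5 -> exists c e, w = (c * A4 + e * B4) *: x4 + (c * A5 + e * B5) *: x5.
    case/L5_rmul_y2 => t /L3_coord[c [e [z'' z''L4 ->]]] ->.
    exists c, e; rewrite ry2 // -/A -/B eA eB !scalerDr !scalerA addrACA.
    by rewrite -!scalerDl.
  have [[c [e x4E]] [c' [e' x5E]]] := (img _ x4L5, img _ x5L5).
  have e44 := congr1 (saa_form^~ y4) x4E; have e45 := congr1 (saa_form^~ y5) x4E.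
  have e54 := congr1 (saa_form^~ y4) x5E; have e55 := congr1 (saa_form^~ y5) x5E.
  move: e44 e45 e54 e55; rewrite !saa_formE !xy //=.
  rewrite !(mulr0, mulr1, addr0, add0r) => e44 e45 e54 e55.
  apply/eqP => D0; have /eqP := oner_neq0 F; apply.
  transitivity ((c * e' - e * c') * D); last by rewrite D0 mulr0.
  transitivity ((c * A4 + e * B4) * (c' * A5 + e' * B5)
      - (c * A5 + e * B5) * (c' * A4 + e' * B4)); last by rewrite /D; ring.
  by rewrite -e44 -e45 -e54 -e55; ring.
(* y_4', y_5' is the basis dual to x_4' = x_1' y_2, x_5' = y_1' y_2; the factor d in
   y_3' makes y_1' y_3' equal to x_4'; x_2' and x_3' compensate for y_3'. *)
pose x1' := al *: x1 + be *: y1.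
pose y1' := (ga / d) *: x1 + (de / d) *: y1.
pose x2' := x2 + a *: x3.
pose x3' := d^-1 *: x3.
pose y3' := d *: y3 + (- (d * a)) *: y2.
pose p1 := al * A4 + be * B4; pose p2 := al * A5 + be * B5.
pose q1 := (ga * A4 + de * B4) / d; pose q2 := (ga * A5 + de * B5) / d.
pose x4' := p1 *: x4 + p2 *: x5.
pose x5' := q1 *: x4 + q2 *: x5.
pose y4' := (q2 / D) *: y4 + (- q1 / D) *: y5.
pose y5' := (- p2 / D) *: y4 + (p1 / D) *: y5.
pose x' := family5 x1' x2' x3' x4' x5'; pose y' := family5 y1' y2 y3' y4' y5'.
have d0' : al * de - be * ga != 0 by [].
have D0' : A4 * B5 - A5 * B4 != 0 by [].
have hyp' : hyperbolic x' y'.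
  split; elim/forall_ord5; elim/forall_ord5; rewrite /x' /y' !family5E;
    rewrite ?inord5_eq // /x1' /y1' /x2' /x3' /y3' /x4' /x5' /y4' /y5' ?saa_formE;
    rewrite ?xx ?yy ?xy ?yx //= /p1 /p2 /q1 /q2 /d /D; field; rewrite ?d0' ?D0' //.
have sb' := hyperbolic_basis (standard_basis_dim sb) hyp'.
have [_ _ _ [/subvP ZL4 _ _]] := sf.
have x4'E : x4' = al *: A + be *: B.
  by rewrite eA eB !scalerDr !scalerA addrACA -!scalerDl.
have x5'E : x5' = (ga / d) *: A + (de / d) *: B.
  rewrite eA eB !scalerDr !scalerA addrACA -!scalerDl.
  by congr (_ *: _ + _ *: _); rewrite /q1 /q2; field.
exists x', y'; split.
  rewrite /flag_basis /x' /y' !family5E.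
  have y3Z4' : y3' \in ucs L 4 by rewrite memvD ?memvZ.
  by do !split=> //; rewrite ?memvD ?memvZ // ZL4.
rewrite /pencil_basis /x' /y' !family5E x4'E x5'E !saa_mulE -/A -/B -/C -/E.
split=> //.
- apply: saa_form_inj => w; have := congr1 (saa_form^~ w) eqC.
  rewrite linear0l !saa_formE => eC.
  transitivity (d * (al * saa_form C w + be * saa_form E w
      - a * (al * saa_form A w + be * saa_form B w))); first by ring.
  by rewrite eC subrr mulr0.
- apply: saa_form_inj => w; have := congr1 (saa_form^~ w) eqE.
  rewrite !saa_formE => eE.
  transitivity (ga * saa_form C w + de * saa_form E w
      - a * (ga * saa_form A w + de * saa_form B w)); first by field.
  by rewrite eE addrC addKr.
Qed.

End Adapted.

Lemma P10_3_7_exists (F : fieldType) (L : saa F) :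
    prodsv (lcs L 3) (lcs L 2) = lcs L 5 -> typeB L ->
  exists r : F, r != 0 /\ has_presentation L (P10_3_7 r).
Proof.
move=> L5 [x [y [ab [a minp]]]].
have [u [v [uL3 vL3 n0 uy3 vy3]]] := tau_pencil ab L5 minp.
have [x' [y' [fb pb]]] := adapted_pencil_basis ab L5 uL3 vL3 n0 uy3 vy3.
have sf := adapted_series_facts ab L5.
have r0 := flag_trip_neq0 sf fb.
exists (trip (x' (inord 1)) (y' (inord 3)) (y' (inord 4))); split=> //.
exact: pencil_basis_presentation.
Qed.

Theorem proposition4p12 (F : fieldType) :
  (forall L : saa F,
      saa_nilpotent L ->
      \dim {:L} = 10%N ->
      isotropic (centre L) -> \dim (centre L) = 3%N ->
      \dim (lcs L 3) = 6%N ->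
      prodsv (lcs L 3) (lcs L 2) = lcs L 5 ->
      typeB L ->
      exists r : F, r != 0 /\ has_presentation L (P10_3_7 r)) /\
  (forall r s : F, r != 0 -> s != 0 ->
     forall L M : saa F,
       has_presentation L (P10_3_7 r) ->
       has_presentation M (P10_3_7 s) ->
       (saa_iso L M <-> exists b : F, b != 0 /\ s / r = b ^+ 3)).
Proof.
split=> [L _ _ _ _ _|r s r0 s0 L M]; first exact: P10_3_7_exists.
exact: P10_3_7_iso.
Qed.
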